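(* (a) There is a constant $C>0$ such that for every positive integer $n$ and all sufficiently large $m$, \[ s(m,n,2)\le C\cdot m^{1-\frac{1}{4n+1}}. \] (b) Let $n\ge 4$ be an integer. There is a constant $D>0$ such that for all sufficiently large $m$, \[ s(m,n,2)\ge D\, m^{1-\frac{1}{\lfloor n/4\rfloor}}. \]
   Context: Let $[m]=\{1,\dots,m\}$. An $(m,n,s)$-storing scheme is a map $\phi$ from the family of subsets of $[m]$ of size at most $n$ to $\{0,1\}^s$. An $(m,s,t)$-query scheme is a family $\{T_u\}_{u\in[m]}$ of Boolean decision trees of depth at most $t$: each internal node is marked with an index in $\{1,\dots,s\}$ (the address of a bit of an $s$-bit string), has one outgoing edge labelled $0$ and one labelled $1$, and each leaf is marked Yes or No; $T_u$ thus maps $\{0,1\}^s$ to $\{\mathrm{Yes},\mathrm{No}\}$ by following, from the root, the edges given by the probed bits (probes may be adaptive). An $(m,n,s,t)$-scheme is a pair of an $(m,n,s)$-storing scheme $\phi$ and an $(m,s,t)$-query scheme $\{T_u\}$ such that for every $S\subseteq[m]$ with $|S|\le n$ and every $u\in[m]$, $T_u(\phi(S))=\mathrm{Yes}$ iff $u\in S$. $s(m,n,t)$ denotes the minimum $s$ for which an $(m,n,s,t)$-scheme exists. *)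

(* Defs.v *)
From HB Require Import structures.
From mathcomp Require Import all_boot all_order all_algebra.
From mathcomp Require Import boolp reals exp.

Set Implicit Arguments.
Unset Strict Implicit.
Unset Printing Implicit Defensive.

(* Leaves: [true] stands for Yes, [false] for No. *)
Inductive dtree (s : nat) : Type :=
| Leaf (answer : bool)
| Probe (i : 'I_s) (child0 child1 : dtree s).

Arguments Leaf {s} answer.

Fixpoint depth s (T : dtree s) : nat :=
  match T with
  | Leaf _ => 0
  | Probe _ T0 T1 => (maxn (depth T0) (depth T1)).+1
  end.

Fixpoint eval s (T : dtree s) (w : s.-tuple bool) : bool :=
  match T with
  | Leaf b => b
  | Probe i T0 T1 => if tnth w i then eval T1 w else eval T0 w
  end.

Definition storing_scheme (m n s : nat) : Type :=
  {S : {set 'I_m} | #|S| <= n} -> s.-tuple bool.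

Definition query_scheme (m s t : nat) : Type :=
  'I_m -> {T : dtree s | depth T <= t}.

Definition is_scheme m n s t
    (phi : storing_scheme m n s) (T : query_scheme m s t) : Prop :=
  forall (S : {S : {set 'I_m} | #|S| <= n}) (u : 'I_m),
    eval (sval (T u)) (phi S) = true <-> u \in sval S.

Definition has_scheme (m n s t : nat) : Prop :=
  exists (phi : storing_scheme m n s) (T : query_scheme m s t), is_scheme phi T.

(* The value is 0 when no scheme exists, which can only happen for t = 0;
   see [has_schemeT] and [min_spaceP]. *)
Definition min_space (m n t : nat) : nat :=
  if pselect (exists s, `[< has_scheme m n s t >]) is left ex_s
  then ex_minn ex_s else 0.

(* The characteristic vector, read with one probe. *)
Lemma has_schemeT m n t : 0 < t -> has_scheme m n m t.
Proof.
move=> t_gt0.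
have dP (u : 'I_m) : depth (Probe u (Leaf false) (Leaf true)) <= t by [].
exists (fun S : {S : {set 'I_m} | #|S| <= n} => [tuple u \in sval S | u < m]).
exists (fun u => exist _ (Probe u (Leaf false) (Leaf true)) (dP u)).
by move=> S u; rewrite /= tnth_mktuple; case: ifP.
Qed.

Lemma min_spaceP m n t : 0 < t ->
  has_scheme m n (min_space m n t) t /\
  forall s, has_scheme m n s t -> min_space m n t <= s.
Proof.
move=> t_gt0; rewrite /min_space; case: pselect => [ex_s|[]]; last first.
  by exists m; apply/asboolP; exact: has_schemeT.
case: ex_minnP => s /asboolP hs s_min; split=> // s' hs'.
by apply: s_min; apply/asboolP.
Qed.

(* Main.v *)
(** (a) Take a bipartite graph between N blocks and N positions in which every
    block has degree 2k and no cycle has length at most 4n; a maximal graph with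
    bounded degrees and no such cycle will do, as balls of radius 4n - 1 are
    small compared with N. An element is a block
    together with two of its edges; the bit of the block chooses which of the two
    positions is probed next. The at most 2n positions that the elements of a set
    S may use span a forest, and peeling off leaves yields block bits for which
    at most one block is directed to each of these positions, so that no element
    outside S is directed to a position used by S.

    (b) At least m/16 elements share the Boolean function that their tree
    computes from its two probed bits. Among them keep a set of elements in which
    every nonempty class with a common first or second probe has size at least d.
    Guess the first-probe bit of one element. If u and v may read the same second
    position and one of them is in S while the other is not, then the first-probe
    bit of one determines that of the other. Exploring these implications
    breadth-first multiplies the number of positions by about d at each level. If
    d^(t+1) exceeds s, then two of them coincide after at most t levels, and this
    refutes the guess at the cost of 2t + 1 elements of S. Refuting both guesses
    with disjoint sets of elements takes 4t + 2 <= n elements, so d^(t+1) = O(s)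
    with t + 1 = n %/ 4. *)

Require Import Defs.
From mathcomp Require Import all_boot all_order all_algebra.
From mathcomp Require Import boolp reals exp.
From mathcomp Require Import zify lra.

Set Implicit Arguments.
Unset Strict Implicit.

(** * The lower bound *)

(** Double counting of the pairs in [r]: at least [k] for each [u], at most one for each [v]. *)
Lemma leq_mul_card (I J : finType) (X : {set I}) (Y : {set J})
    (r : I -> J -> bool) k :
  (forall u, u \in X -> k <= #|[set v in Y | r u v]|) ->
  (forall v u u', v \in Y -> u \in X -> u' \in X -> r u v -> r u' v -> u = u') ->
  k * #|X| <= #|Y|.
Proof.
move=> kX rinj; rewrite mulnC -sum_nat_const.
apply: (@leq_trans (\sum_(u in X) \sum_(v in Y | r u v) 1)).
  apply: leq_sum => u uX; rewrite sum1_card (leq_trans (kX _ uX)) //.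
  by apply: subset_leq_card; apply/subsetP => v; rewrite !inE.
rewrite (exchange_big_dep (mem Y)) /=; last by move=> u v _ /andP[].
rewrite -sum1_card; apply: leq_sum => v vY; rewrite sum1_card.
apply/card_le1_eqP => u u' /andP[uX /andP[_ ruv]] /andP[u'X /andP[_ ru'v]].
exact: (rinj v).
Qed.

(** The count behind [exits_grow]. For [d > 2], [E >= T - B >= T * (d - 1) / d >= X * (d - 1)^2 /
    d], and [(d - 1)^2 >= d * (d - 2)]. *)
Lemma exits_growth_arith d T B X E :
  T <= E + B -> d * B <= T -> (d - 1) * X <= T -> (d - 2) * X <= E.
Proof.
move=> TEB dB dX; have [d2|d2] := leqP d 2; first by have -> : d - 2 = 0 by lia.
have [c dE] : exists c, d = c + 3 by exists (d - 3); lia.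
subst d; have -> : c + 3 - 2 = c.+1 by lia.
have : c.+2 * X <= T by have -> : c.+2 = c + 3 - 1 by lia.
nia.
Qed.

(** * Refuting a guess by breadth-first search *)

Section Search.
Variables (U A P : finType) (a : U -> A) (pos : bool -> U -> P).

(* [x] lists the first-probe bits; [z b p] is the answer when the first probed bit
   is [b] and the second probed position is [p]. *)
Definition answer (x : A -> bool) (z : bool -> P -> bool) (y : U) : bool :=
  z (x (a y)) (pos (x (a y)) y).

(** Recording the queried elements [E] apart from [S] lets refutations on disjoint [E] be merged
    into one set. *)
Definition refutes (E S : {set U}) (i : A) (b : bool) : Prop :=
  forall x z, (forall y, y \in E -> answer x z y = (y \in S)) -> x i <> b.

Definition min_degree (d : nat) (W : {set U}) : Prop :=
  (forall y, y \in W -> d <= #|[set v in W | a v == a y]|) /\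
  (forall b y, y \in W -> d <= #|[set v in W | pos b v == pos b y]|).

Section Tree.
Variables (W : {set U}) (i : A) (b0 : bool).

(* [R] is the set of first-probe positions reached from the guess [x i = b0] in at
   most [t] steps, with the values [st] that it forces. Position [w] is reached
   through the element [e w] of [w], which shares a second position with the
   element [p w] of the parent of [w]; the membership of [p w] in the set will be
   opposite to that of [e w]. Parents are never entry elements, so that their
   membership can be chosen freely. The entry of the root is a dummy. *)
Record search_tree (t : nat) (R : {set A}) (st : A -> bool) (e p : A -> U) :
    Prop := SearchTree {
  tree_root : i \in R;
  tree_entry : forall w, w \in R -> e w \in W /\ a (e w) = w;
  tree_parent : forall w, w \in R -> w != i ->
    [/\ p w \in W, a (p w) \in R & p w != e (a (p w))];
  tree_forced : forall w, w \in R -> exists Q : {set A},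
    [/\ Q \subset R :\ i, #|Q| <= t &
     forall x z (M : U -> bool),
       (forall q, q \in Q -> [/\ M (e q) = ~~ M (p q),
          answer x z (e q) = M (e q) & answer x z (p q) = M (p q)]) ->
       x i = b0 -> x w = st w] }.

(** Under the guess, [u] and [v] read equal first bits and then the same position, so their answers
    agree. The membership of [u] is free as [u] is not an entry; [v] may be one. *)
Definition clash (R : {set A}) (st : A -> bool) (e : A -> U) (u v : U) : Prop :=
  [/\ u \in W, v \in W, a u \in R & a v \in R] /\
  [/\ u != e (a u), v != u, st (a v) = st (a u) &
      pos (st (a u)) v = pos (st (a u)) u].

(** Put [u] in the set and keep [v] out. At most [2 * t] steps of the tree force both first bits;
    each costs an entry and a parent, exactly one of which is in the set. *)
Lemma clash_refutes t R st e p u v :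
  search_tree t R st e p -> clash R st e u v ->
  exists E S : {set U}, [/\ E \subset W, S \subset E, #|E| <= 4 * t + 2,
    #|S| <= 2 * t + 1 & refutes E S i b0].
Proof.
move=> [iR eP pP fP] [[uW vW uR vR] [ue vu stE posE]].
have [Qu [QuR Qut Fu]] := fP _ uR; have [Qv [QvR Qvt Fv]] := fP _ vR.
pose Q := Qu :|: Qv.
have Qt : #|Q| <= 2 * t by rewrite (leq_trans (leq_card_setU _ _)) // mul2n -addnn leq_add.
have QR q : q \in Q -> q \in R /\ q != i.
  by rewrite inE => /orP[/(subsetP QuR)|/(subsetP QvR)]; rewrite !inE => /andP[].
(* All elements but [v] that are not entries are put in the set. *)
pose M0 y := y != v.
pose M y := if [&& a y \in R, a y != i & y == e (a y)]
  then ~~ M0 (p (a y)) else M0 y.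
have Mp q : q \in Q -> M (p q) = M0 (p q).
  by case/QR=> qR qi; have [_ _ /negbTE pe] := pP _ qR qi; rewrite /M pe !andbF.
have Me q : q \in Q -> M (e q) = ~~ M (p q).
  move=> qQ; rewrite (Mp _ qQ); have [qR qi] := QR _ qQ.
  by rewrite /M; have [_ ->] := eP _ qR; rewrite qR qi eqxx.
have Mu : M u = true by rewrite /M (negbTE ue) !andbF /M0 eq_sym.
have Mv : M v = false.
  (* If [v] is a non-root entry, its parent differs from [v], since parents are not entries; so the
     parent is in the set and [v] is not. *)
  rewrite /M; case: ifPn => [/and3P[_ vi /eqP ve]|_]; last by rewrite /M0 eqxx.
  have [_ _ pe] := pP _ vR vi; rewrite /M0 negbK.
  by apply: contraNF pe => /eqP ->; apply/eqP.
pose E := [set u; v] :|: (e @: Q :|: p @: Q).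
exists E, [set y in E | M y]; split.
- apply/subsetP => y; rewrite !inE => /orP[/orP[]/eqP->//|/orP[]/imsetP[q /QR[qR qi] ->]].
    by case: (eP _ qR).
  by case: (pP _ qR qi).
- by apply/subsetP => y; rewrite inE => /andP[].
- rewrite (leq_trans (leq_card_setU _ _)) // addnC leq_add //.
    rewrite (leq_trans (leq_card_setU _ _)) //.
    rewrite (leq_trans (leq_add (leq_imset_card e Q) (leq_imset_card p Q))) //.
    by rewrite addnn -mul2n (leq_trans (leq_mul (leqnn 2) Qt)) // mulnA.
  by rewrite cards2; case: eqP.
- pose h q := if M (e q) then e q else p q.
  apply: (@leq_trans #|u |: h @: Q|); last first.
    rewrite (leq_trans (leq_card_setU _ _)) // cards1 addnC leq_add2r.
    exact: leq_trans (leq_imset_card h Q) Qt.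
  apply: subset_leq_card; apply/subsetP => y; rewrite !inE.
  case/andP=> /orP[/orP[/eqP->|/eqP->]|/orP[/imsetP[q qQ ->]|/imsetP[q qQ ->]]] My.
  + by rewrite eqxx.
  + by rewrite Mv in My.
  + by apply/orP; right; apply/imsetP; exists q; rewrite // /h My.
  + by apply/orP; right; apply/imsetP; exists q; rewrite // /h Me // My.
- move=> x z ansE xi.
  have ans y : y \in E -> answer x z y = M y by move=> yE; rewrite ansE // inE yE.
  have ansQ q : q \in Q -> [/\ M (e q) = ~~ M (p q),
      answer x z (e q) = M (e q) & answer x z (p q) = M (p q)].
    by move=> qQ; split; [exact: Me| |]; apply: ans; rewrite !inE (imset_f _ qQ) ?orbT.
  have xu : x (a u) = st (a u).
    by apply: (Fu x z M) => // q qQ; apply: ansQ; rewrite inE qQ.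
  have xv : x (a v) = st (a v).
    by apply: (Fv x z M) => // q qQ; apply: ansQ; rewrite inE qQ orbT.
  have : answer x z u = answer x z v.
    by rewrite /answer xu xv stE posE.
  by rewrite !ans ?Mu ?Mv // !inE eqxx ?orbT.
Qed.

(** One breadth-first level. If [v] had the first bit [st (a u)], it would read the same position as
    [u]; as their memberships differ, [v] is forced to the opposite bit. *)
Lemma search_tree_grow t R st e p : search_tree t R st e p ->
  exists R' st' e' p', [/\ search_tree t.+1 R' st' e' p',
    forall w, w \in R -> [/\ w \in R', st' w = st w & e' w = e w] &
    forall u v, u \in W -> v \in W -> a u \in R -> u != e (a u) ->
      pos (st (a u)) v = pos (st (a u)) u -> a v \in R'].
Proof.
move=> [iR eP pP fP].
(* [reach w (v, u)]: [v] can be the entry of [w], with [u] as parent. *)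
pose reach w (vu : U * U) := [&& a vu.1 == w, vu.2 \in W, vu.1 \in W,
  a vu.2 \in R, vu.2 != e (a vu.2) &
  pos (st (a vu.2)) vu.1 == pos (st (a vu.2)) vu.2].
pose pk w := [pick vu | reach w vu].
pose R' := R :|: [set w | [exists vu, reach w vu]].
pose st' w := if w \in R then st w else
  if pk w is Some vu then ~~ st (a vu.2) else st w.
pose e' w := if w \in R then e w else if pk w is Some vu then vu.1 else e w.
pose p' w := if w \in R then p w else if pk w is Some vu then vu.2 else p w.
have old w : w \in R -> [/\ w \in R', st' w = st w, e' w = e w & p' w = p w].
  by move=> wR; rewrite /R' /st' /e' /p' inE wR.
have new w : w \in R' -> w \notin R -> exists v u,
    [/\ reach w (v, u), st' w = ~~ st (a u), e' w = v & p' w = u].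
  rewrite /R' /st' /e' /p' !inE => /orP[->//|/existsP[vu vuP] /negbTE->].
  rewrite /pk; case: pickP => [[v u] vu'P|/(_ vu)]; last by rewrite vuP.
  by exists v, u.
exists R', st', e', p'; split; last first.
- move=> u v uW vW uR ue puv; rewrite /R' !inE; apply/orP; right.
  by apply/existsP; exists (v, u); rewrite /reach /= eqxx uW vW uR ue puv eqxx.
- by move=> w /old[].
split.
- by case: (old _ iR).
- move=> w wR'; have [wR|wR] := boolP (w \in R).
    by case: (old _ wR) => _ _ -> _; exact: eP.
  by have [v [u [/and3P[/eqP/= aw _ /andP[vW _]] _ -> _]]] := new _ wR' wR.
- move=> w wR' wi; have [wR|wR] := boolP (w \in R).
    have [_ _ _ ->] := old _ wR; have [pW paR pe] := pP _ wR wi.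
    by have [-> _ -> _] := old _ paR.
  have [v [u [/and5P[/eqP/= aw uW vW uR /andP[ue _]] _ _ ->]]] := new _ wR' wR.
  by have [-> _ -> _] := old _ uR.
- move=> w wR'; have [wR|wR] := boolP (w \in R).
    have [Q [QR Qt FQ]] := fP _ wR; exists Q; split.
    + apply: subset_trans QR _; apply: setSD; apply: subsetUl.
    + exact: leqW.
    + move=> x z M QM xi; have [_ -> _ _] := old _ wR.
      apply: (FQ x z M) => // q qQ; have := subsetP QR _ qQ.
      by rewrite !inE => /andP[_ /old[_ _ <- <-]]; exact: QM.
  have [v [u [/and5P[/eqP/= aw uW vW uR /andP[ue /eqP puv]] stw ew pw]]] := new _ wR' wR.
  have [Q [QR Qt FQ]] := fP _ uR; exists (w |: Q); split.
  + rewrite subUset sub1set !inE /=; apply/andP; split.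
      by apply/andP; split; [apply: contraNneq wR => ->|move: wR'; rewrite !inE].
    by apply: subset_trans QR _; apply: setSD; apply: subsetUl.
  + by rewrite (leq_trans (leq_card_setU _ _)) // cards1.
  + move=> x z M QM xi; have xu : x (a u) = st (a u).
      apply: (FQ x z M) => // q qQ; have := subsetP QR _ qQ.
      rewrite !inE => /andP[_ /old[_ _ <- <-]]; apply: QM.
      by rewrite !inE qQ orbT.
    have := QM w; rewrite !inE eqxx => /(_ isT)[]; rewrite ew pw => Muv ansv ansu.
    rewrite stw; move: ansv ansu; rewrite /answer xu aw Muv.
    case: (eqVneq (x w) (st (a u))) => [->|]; last first.
      by case: (x w); case: (st (a u)).
    by rewrite puv => ->; case: (M u).
Qed.


(* The elements from which the tree can be continued. *)
Definition exits (R : {set A}) (st : A -> bool) (e : A -> U) (b : bool) :=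
  [set y in W | [&& a y \in R, st (a y) == b & y != e (a y)]].

Lemma exits_inj R st e b : (forall u v, ~ clash R st e u v) ->
  {in exits R st e b &, injective (pos b)}.
Proof.
move=> nc u v; rewrite !inE => /and4P[uW uR /eqP ub ue] /and4P[vW vR /eqP vb ve] puv.
apply: contra_notP (nc u v) => /eqP; rewrite eq_sym => vu.
by split; split; rewrite // ?ub ?vb.
Qed.

(** An exit shares its second position with [d - 1] other elements, all forced to [~~ b] for lack of
    a clash; by [exits_inj] these families are disjoint. Each first position forced to [~~ b]
    carries at least [d] elements, and only its entry is lost. *)
Lemma exits_grow d t R st e p t' R' st' e' p' b :
  min_degree d W ->
  search_tree t R st e p -> search_tree t' R' st' e' p' ->
  (forall w, w \in R -> [/\ w \in R', st' w = st w & e' w = e w]) ->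
  (forall u v, u \in W -> v \in W -> a u \in R -> u != e (a u) ->
     pos (st (a u)) v = pos (st (a u)) u -> a v \in R') ->
  (forall u v, ~ clash R' st' e' u v) ->
  (d - 2) * #|exits R st e b| <= #|exits R' st' e' (~~ b)|.
Proof.
move=> [da dp] tR tR' RR' posR' nc.
pose T := [set y in W | (a y \in R') && (st' (a y) == ~~ b)].
pose B := [set w in R' | st' w == ~~ b].
apply: (@exits_growth_arith d #|T| #|B|).
- rewrite addnC; apply: (@leq_trans #|e' @: B :|: exits R' st' e' (~~ b)|).
    apply: subset_leq_card; apply/subsetP => y; rewrite !inE => /and3P[yW yR' yb].
    have [ye|] := eqVneq y (e' (a y)); last by rewrite yW yR' yb orbT.
    by apply/orP; left; apply/imsetP; exists (a y); rewrite // inE yR'.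
  by rewrite (leq_trans (leq_card_setU _ _)) // leq_add2r leq_imset_card.
- apply: (@leq_mul_card _ _ B T (fun w y => a y == w)).
    move=> w; rewrite inE => /andP[wR' wb]; have [eW ew] := tree_entry tR' wR'.
    rewrite (leq_trans (da _ eW)) // ew; apply: subset_leq_card.
    by apply/subsetP => y; rewrite !inE => /andP[-> /eqP->]; rewrite wR' wb eqxx.
  by move=> y w w' _ _ _ /eqP<- /eqP<-.
- apply: (@leq_mul_card _ _ _ T (fun u v => (v != u) && (pos b v == pos b u))).
    move=> u; rewrite inE => /and4P[uW uR /eqP ub ue].
    have [uR' us ue'] := RR' _ uR.
    have := dp b u uW; rewrite (cardsD1 u) !inE uW eqxx leq_subLR.
    move=> /leq_trans->//; rewrite leq_add2l; apply: subset_leq_card.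
    apply/subsetP => v; rewrite !inE => /and3P[vu vW puv].
    have vR' : a v \in R' by apply: (posR' u) => //; rewrite ub; apply/eqP.
    rewrite vW vR' vu puv /= andbT; apply: contraT => vb.
    case: (nc u v); split; split; rewrite // ?ue' ?us ?ub //; last exact/eqP.
    by move: vb; case: (st' (a v)); case: (b).
  move=> v u u' _ uE u'E /andP[_ /eqP pu] /andP[_ /eqP pu'].
  have ex y : y \in exits R st e b -> y \in exits R' st' e' b.
    rewrite !inE => /and4P[yW yR yb ye].
    by have [-> -> ->] := RR' _ yR; rewrite yW yb ye.
  by apply: (exits_inj nc (ex _ uE) (ex _ u'E)); rewrite -pu.
Qed.

End Tree.

(** Until a clash occurs, each level multiplies the exits by at least [d - 2]; without one they
    inject into [P] by [exits_inj]. *)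
Lemma exists_refutation d W y0 b0 t :
  min_degree d W -> y0 \in W -> #|P| < (d - 2) ^ t.+1 ->
  exists E S : {set U}, [/\ E \subset W, S \subset E, #|E| <= 4 * t + 2,
    #|S| <= 2 * t + 1 & refutes E S (a y0) b0].
Proof.
move=> dW y0W Pd.
pose found r := exists E S : {set U}, [/\ E \subset W, S \subset E,
  #|E| <= 4 * r + 2, #|S| <= 2 * r + 1 & refutes E S (a y0) b0].
pose noclash R st e := forall u v, ~ clash W R st e u v.
have tree_or R st e p r : search_tree W (a y0) b0 r R st e p ->
    found r \/ noclash R st e.
  move=> tR; have [[u [v cl]]|nc] := pselect (exists u v, clash W R st e u v).
    by left; exact: clash_refutes tR cl.
  by right => u v cl; apply: nc; exists u, v.
have found_le r r' : r <= r' -> found r -> found r'.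
  move=> rr' [E [S [EW SE Er Sr ref]]]; exists E, S; split => //.
    by rewrite (leq_trans Er) // leq_add2r leq_mul2l.
  by rewrite (leq_trans Sr) // leq_add2r leq_mul2l.
suff [//|[R [st [e [p [b [_ nc]]]]]]] : found t \/ exists R st e p b,
    [/\ search_tree W (a y0) b0 t R st e p, noclash R st e &
        (d - 2) ^ t.+1 <= #|exits W R st e b|].
  move=> dE; suff : (d - 2) ^ t.+1 <= #|P| by rewrite leqNgt Pd.
  by rewrite (leq_trans dE) // -(card_in_imset (exits_inj nc)) max_card.
elim: t {Pd} => [|t IH].
  have t0 : search_tree W (a y0) b0 0 [set a y0] (fun=> b0) (fun=> y0) (fun=> y0).
    split=> //; first by rewrite inE.
    - by move=> w /set1P->.
    - by move=> w /set1P->; rewrite eqxx.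
    - move=> w /set1P->; exists set0; split; rewrite ?sub0set ?cards0 //.
  have [f|nc] := tree_or _ _ _ _ _ t0; first by left.
  right; exists [set a y0], (fun=> b0), (fun=> y0), (fun=> y0), b0; split=> //.
  (* The class of the root has at least [d - 1] elements besides its dummy entry [y0]. *)
  have := dW.1 _ y0W; rewrite (cardsD1 y0) !inE y0W eqxx /= expn1 => dle.
  rewrite leq_subLR (leq_trans dle) // leq_add //; apply: subset_leq_card.
  by apply/subsetP => y; rewrite !inE eqxx => /and3P[-> -> ->].
case: IH => [f|[R [st [e [p [b [tR nc dE]]]]]]].
  by left; apply: found_le f.
have [R' [st' [e' [p' [tR' RR' posR']]]]] := search_tree_grow tR.
have [f|nc'] := tree_or _ _ _ _ _ tR'; first by left.
right; exists R', st', e', p', (~~ b); split=> //.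
rewrite expnS (leq_trans _ (exits_grow b dW tR tR' RR' posR' nc')) //.
by rewrite leq_mul2l dE orbT.
Qed.


(** * Subsets of large minimum degree *)

Definition num_classes (W : {set U}) :=
  #|a @: W| + #|pos false @: W| + #|pos true @: W|.

Lemma card_class_remove (T : finType) (f : U -> T) (W : {set U}) y : y \in W ->
  #|f @: (W :\: [set v in W | f v == f y])| < #|f @: W|.
Proof.
move=> yW; apply: proper_card; apply/properP; split.
  by apply: imsetS; apply: subsetDl.
exists (f y); first exact: imset_f.
by apply/imsetP => -[v]; rewrite !inE => /andP[+ vW] fv; rewrite vW fv eqxx.
Qed.

(** Delete classes of size less than [d] one by one. Each deletion lowers [num_classes], so the
    strict inequality persists and the set never becomes empty. *)
Lemma min_degree_subset d W : d * num_classes W < #|W| ->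
  exists W' : {set U}, [/\ W' \subset W, W' != set0 & min_degree d W'].
Proof.
have [k] := ubnP #|W|; elim: k W => // k IH W Wk dW.
have [minW|] := pselect (min_degree d W).
  exists W; split=> //; rewrite -card_gt0; exact: leq_ltn_trans dW.
move=> notmin.
have [C [CW Cd C0 Ccl]] : exists C : {set U},
    [/\ C \subset W, #|C| < d, C != set0 & num_classes (W :\: C) < num_classes W].
  have imD (T : finType) (f : U -> T) (C : {set U}) : #|f @: (W :\: C)| <= #|f @: W|.
    by apply: subset_leq_card; apply: imsetS; apply: subsetDl.
  apply: contra_notP notmin => noC; split=> [y yW|b y yW]; rewrite leqNgt;
    apply/negP => dlt; apply: noC.
    exists [set v in W | a v == a y]; split=> //.
    - by apply/subsetP => v; rewrite inE => /andP[].
    - by apply/set0Pn; exists y; rewrite inE yW eqxx.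
    - rewrite /num_classes -!addnA -addSn leq_add ?leq_add ?imD //.
      exact: card_class_remove.
  exists [set v in W | pos b v == pos b y]; split=> //.
  - by apply/subsetP => v; rewrite inE => /andP[].
  - by apply/set0Pn; exists y; rewrite inE yW eqxx.
  - have := card_class_remove (pos b) yW; rewrite /num_classes.
    case: b {dlt} => lt.
      by rewrite -addnS leq_add ?leq_add ?imD.
    by rewrite addnAC [X in _ < X]addnAC -addnS leq_add ?leq_add ?imD.
have CW' : #|W :\: C| = #|W| - #|C| by rewrite cardsD (setIidPr CW).
have C0' : 0 < #|C| by rewrite card_gt0.
have CleW : #|C| <= #|W| by apply: subset_leq_card.
have [||W' [W'W W'0 minW']] := IH (W :\: C).
- by rewrite CW'; lia.
- by rewrite CW'; move: dW Ccl Cd CleW; move: (num_classes _) (num_classes _); nia.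
by exists W'; split=> //; apply: subset_trans W'W (subsetDl _ _).
Qed.

Lemma min_degreeD d k (W E : {set U}) :
  #|E| <= k -> min_degree d W -> min_degree (d - k) (W :\: E).
Proof.
move=> Ek [da dp].
have D (T : finType) (f : U -> T) y : y \in W -> d <= #|[set v in W | f v == f y]| ->
    d - k <= #|[set v in W :\: E | f v == f y]|.
  move=> yW dle; rewrite leq_subLR (leq_trans dle) //.
  apply: (@leq_trans (#|E| + #|[set v in W :\: E | f v == f y]|)); last by rewrite leq_add2r.
  apply: leq_trans (leq_card_setU _ _); apply: subset_leq_card.
  by apply/subsetP => v; rewrite !inE => /andP[-> ->]; case: (v \in E).
by split=> [y|b y]; rewrite inE => /andP[_ yW]; apply: D => //; [exact: da|exact: dp].
Qed.

(** Refute [false] on [E0], then [true] for the same first position outside [E0]. Removing [E0]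
    costs [4 * t + 2] in degree, and the growth factor of the search costs 2 more. *)
Lemma unsatisfiable_set d W t :
  d * num_classes W < #|W| -> #|P| < (d - (4 * t + 4)) ^ t.+1 ->
  exists2 S : {set U}, S \subset W & #|S| <= 4 * t + 2 /\
    forall x z, ~ forall y, y \in W -> answer x z y = (y \in S).
Proof.
move=> dW Pd; have [W' [W'W /set0Pn[y0 y0W'] minW']] := min_degree_subset dW.
have d_gt : 4 * t + 4 < d.
  by rewrite ltnNge; apply: contraTN Pd => /eqP->; rewrite exp0n.
have [|E0 [S0 [E0W S0E E0t S0t ref0]]] := exists_refutation false (t := t) minW' y0W'.
  by rewrite (leq_trans Pd) // leq_exp2r // leq_sub2l // !addnS.
have minD := min_degreeD E0t minW'.
have [y1 y1D ay1] : exists2 y1, y1 \in W' :\: E0 & a y1 = a y0.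
  have /subsetPn[y1] : ~~ ([set v in W' | a v == a y0] \subset E0).
    apply/negP => /subset_leq_card; rewrite leqNgt => /negP; apply.
    apply: (leq_trans _ (minW'.1 _ y0W')); rewrite (leq_ltn_trans E0t) //.
    by rewrite (leq_ltn_trans _ d_gt) // leq_add2l.
  by rewrite inE => /andP[y1W /eqP ay1] y1E; exists y1; rewrite // inE y1E.
have [|E1 [S1 [E1W S1E E1t S1t ref1]]] := exists_refutation true (t := t) minD y1D.
  by rewrite -subnDA -addnA.
have E1E0 y : y \in E1 -> y \notin E0 by move/(subsetP E1W); rewrite inE => /andP[].
exists (S0 :|: S1).
  rewrite subUset (subset_trans S0E) ?(subset_trans E0W) //=.
  by rewrite (subset_trans S1E) // (subset_trans E1W) // (subset_trans (subsetDl _ _)).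
split; first by rewrite (leq_trans (leq_card_setU _ _)) // (leq_trans (leq_add S0t S1t)) //; lia.
move=> x z ans.
have x0 : x (a y0) <> false.
  apply: (ref0 x z) => y yE0; rewrite ans ?inE; last first.
    by apply: (subsetP W'W); apply: (subsetP E0W).
  case: (boolP (y \in S1)); last by rewrite orbF.
  by move/(subsetP S1E)/E1E0; rewrite yE0.
have x1 : x (a y1) <> true.
  apply: (ref1 x z) => y yE1; rewrite ans ?inE; last first.
    by apply: (subsetP W'W); move/(subsetP E1W): yE1; rewrite inE => /andP[].
  case: (boolP (y \in S0)) => // /(subsetP S0E) yE0.
  by move/E1E0: yE1; rewrite yE0.
by move: x0 x1; rewrite ay1; case: (x (a y0)).
Qed.

End Search.

(** * From decision trees to the search *)

Lemma eval_depth1 s (T : dtree s) : 0 < s -> depth T <= 1 ->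
  exists (p : 'I_s) (g : bool -> bool), forall w, eval T w = g (tnth w p).
Proof.
move=> s0; case: T => [b|p T0 T1] /=; first by exists (Ordinal s0), (fun=> b).
rewrite ltnS geq_max => /andP[]; case: T0 => [b0|//] _; case: T1 => [b1|//] _.
by exists p, (fun b : bool => if b then b1 else b0) => w /=.
Qed.

(** Short trees are padded with dummy probes, which need an address, whence [0 < s]. The [ffun]
    makes the Boolean functions countable for the pigeonhole. *)
Lemma eval_depth2 s (T : dtree s) : 0 < s -> depth T <= 2 ->
  exists c : 'I_s * (bool -> 'I_s) * {ffun bool * bool -> bool},
    forall w, eval T w = c.2 (tnth w c.1.1, tnth w (c.1.2 (tnth w c.1.1))).
Proof.
move=> s0; case: T => [b|i T0 T1] /=.
  by exists (Ordinal s0, fun=> Ordinal s0, [ffun=> b]) => w; rewrite ffunE.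
rewrite ltnS geq_max => /andP[/(eval_depth1 s0)[p0 [g0 E0]] /(eval_depth1 s0)[p1 [g1 E1]]].
exists (i, fun b : bool => if b then p1 else p0,
        [ffun bc : bool * bool => if bc.1 then g1 bc.2 else g0 bc.2]) => w.
by rewrite ffunE /=; case: (tnth w i); rewrite ?E0 ?E1.
Qed.

(** [48 = 16 * 3]: there are 16 Boolean functions of two bits, and [num_classes] is at most
    [3 * s]. *)
Lemma scheme_lower_bound m n s t d :
  0 < s -> has_scheme m n s 2 -> 4 * t + 2 <= n -> 48 * s * d < m ->
  (d - (4 * t + 4)) ^ t.+1 <= s.
Proof.
move=> s0 [phi [T schemeT]] tn sdm; rewrite leqNgt; apply/negP => sd.
have [c cE] := choice (fun u => eval_depth2 s0 (svalP (T u))).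
pose cls f := [set u | (c u).2 == f].
have [f fW] : exists f, 3 * s * d < #|cls f|.
  apply: contrapT => nof; move: sdm; rewrite ltnNge => /negP; apply.
  rewrite -{1}(card_ord m) -sum1_card (partition_big (fun u => (c u).2) predT) //=.
  apply: (@leq_trans (\sum_(f : {ffun bool * bool -> bool}) 3 * s * d)).
    apply: leq_sum => f _; rewrite leqNgt; apply/negP => lt; apply: nof; exists f.
    by rewrite (leq_trans lt) // sum1dep_card.
  by rewrite sum_nat_const card_ffun card_prod card_bool !mulnA.
pose a u := (c u).1.1; pose pos b u := (c u).1.2 b.
have [||S SW [St unsat]] := @unsatisfiable_set _ _ _ a pos d (cls f) t.
- apply: leq_ltn_trans fW; rewrite mulnC leq_mul2r; apply/orP; right.
  have le (g : 'I_m -> 'I_s) : #|g @: cls f| <= s.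
    by rewrite -[X in _ <= X]card_ord max_card.
  by rewrite /num_classes !mulSn addn0 addnA !leq_add.
- by rewrite card_ord.
have Sn : #|S| <= n by exact: leq_trans St tn.
pose w := phi (exist _ S Sn).
apply: (unsat (tnth w) (fun b p => f (b, tnth w p))) => u; rewrite inE => /eqP uf.
apply/idP/idP.
  by move=> ans; apply/(schemeT (exist _ S Sn)); rewrite cE uf.
by move/(schemeT (exist _ S Sn) u); rewrite cE uf.
Qed.

Lemma has_scheme_gt0 m n s t : 0 < m -> 0 < n -> has_scheme m n s t -> 0 < s.
Proof.
case: s => // m0 n0 [phi [T schemeT]]; pose u := Ordinal m0.
have S1 : #|[set u]| <= n by rewrite cards1.
have S0 : #|set0 : {set 'I_m}| <= n by rewrite cards0.
pose A1 : {S : {set 'I_m} | #|S| <= n} := exist _ [set u] S1.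
pose A0 : {S : {set 'I_m} | #|S| <= n} := exist _ set0 S0.
have : eval (sval (T u)) (phi A0) = true.
  by rewrite tuple0 -(tuple0 (phi A1)); apply/schemeT; rewrite /= inE.
by move/(schemeT A0 u); rewrite /= inE.
Qed.

(** * The upper bound *)

(** Extend a path at its head; by finiteness a vertex must recur, which closes a cycle. *)
Lemma ucycle_min_degree2 (V : finType) (e : rel V) (X : {set V}) :
  symmetric e -> irreflexive e -> X != set0 ->
  (forall x, x \in X -> exists y z, [/\ y \in X, z \in X, y != z, e x y & e x z]) ->
  exists c, [/\ ucycle e c, 2 < size c & {subset c <= X}].
Proof.
move=> esym eirr /set0Pn[x0 x0X] deg2.
have longer k : (exists c, [/\ ucycle e c, 2 < size c & {subset c <= X}]) \/
    exists x s, [/\ size s = k, path e x s, uniq (x :: s) & {subset x :: s <= X}].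
  elim: k => [|k [|[x [s [sk ps us sX]]]]]; [|by left|].
    by right; exists x0, [::]; split=> // x; rewrite inE => /eqP->.
  (* [ohead s] is the preceding vertex, if any; avoiding it makes the cycle longer than 2. *)
  have [z [zX exz zs]] : exists z, [/\ z \in X, e x z & ohead s != Some z].
    have [y [z [yX zX yz exy exz]]] := deg2 x (sX x (mem_head x s)).
    have [sy|] := eqVneq (ohead s) (Some y); last by exists y.
    by exists z; split=> //; rewrite sy; apply: contra_neq yz => -[].
  have [zxs|zxs] := boolP (z \in x :: s); last first.
    right; exists z, (x :: s); split=> /=; first by rewrite sk.
    - by rewrite esym exz.
    - by rewrite zxs.
    - by move=> y; rewrite inE => /orP[/eqP->//|/sX].
  left; move: zxs; rewrite inE => /orP[/eqP zx|zs']; first by rewrite zx eirr in exz.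
  case/splitPr: zs' ps us sX zs => s1 s2; rewrite -cat1s catA cat_path -cat_cons cat_uniq.
  move=> /andP[p1 _] /andP[u1 _] sX zs; exists (x :: s1 ++ [:: z]); split.
  - by rewrite /ucycle /cycle u1 andbT rcons_path p1 last_cat /= esym exz.
  - by move: zs; case: s1 {p1 u1 sX} => [|? ?] /=; rewrite ?eqxx ?size_cat /= ?addn1.
  - by move=> y yc; apply: sX; rewrite mem_cat yc.
have [//|[x [s [sV _ us _]]]] := longer #|V|.
by have := max_card (mem (x :: s)); rewrite (card_uniqP us) /= sV ltnn.
Qed.

(** * Bipartite graphs of large girth *)

Section BipartiteGraph.
Variables X Y : finType.
Implicit Types E : {set X * Y}.

Definition adj E : rel (X + Y) := fun u v => match u, v with
  | inl x, inr y => (x, y) \in E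
  | inr y, inl x => (x, y) \in E
  | _, _ => false
  end.

Lemma adj_sym E : symmetric (adj E).
Proof. by case=> ? []. Qed.

Lemma adj_irr E : irreflexive (adj E).
Proof. by case. Qed.

Definition is_inr (u : X + Y) := if u is inr _ then true else false.

Lemma path_adj_parity E u s : path (adj E) u s ->
  is_inr (last u s) = is_inr u (+) odd (size s).
Proof.
elim: s u => [|v s IH] u /=; first by rewrite addbF.
by move=> /andP[uv /IH->]; case: u v uv => [x|y] [x'|y'] //=; case: (odd _).
Qed.

Lemma path_adj_size E u s : path (adj E) u s ->
  size (u :: s) <= (count is_inr (u :: s)).*2 + ~~ is_inr u.
Proof.
elim: s u => [|v s IH] u /=; first by case: u.
move=> /andP[uv /IH /=]; case: u v uv => [x|y] [x'|y'] //=; lia.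
Qed.

(** By parity, a cycle listed from a vertex of [X] has even size, which removes the excess 1 of
    [path_adj_size]. *)
Lemma ucycle_adj_size E c : ucycle (adj E) c -> size c <= (count is_inr c).*2.
Proof.
case: c => // u s /andP[]; rewrite /= rcons_path => /andP[ps uv] _.
move: (path_adj_size ps) (path_adj_parity ps) uv => {ps} /=.
by case: (last u s) => ?; case: u => ? //=; lia.
Qed.

(** An edge run back and forth is a [ucycle] of size 2, hence the bound [2 < size c]. *)
Definition girth_gt E L := forall c, ucycle (adj E) c -> 2 < size c -> L < size c.

Definition meets E (H : {set Y}) x := [exists y in H, (x, y) \in E].

(** Otherwise [H] and the blocks with two neighbours in [H] induce a graph of minimum degree 2,
    whose cycle has at most [2 * #|H|] vertices. *)
Lemma leaf_position E (H : {set Y}) : girth_gt E (2 * #|H|) -> H != set0 ->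
  exists2 p, p \in H & forall x x', (x, p) \in E -> (x', p) \in E ->
    meets E (H :\ p) x -> meets E (H :\ p) x' -> x = x'.
Proof.
move=> gE H0; apply: contrapT => noleaf.
pose V := [set u | match u with
  | inl x => [exists p in H, ((x, p) \in E) && meets E (H :\ p) x]
  | inr y => y \in H end].
have VH x p : p \in H -> (x, p) \in E -> meets E (H :\ p) x -> inl x \in V.
  by move=> pH xp xH; rewrite inE; apply/existsP; exists p; rewrite pH xp.
have [||c [ccyc c2 cV]] := @ucycle_min_degree2 _ (adj E) V (@adj_sym E) (@adj_irr E).
- by case/set0Pn: H0 => p pH; apply/set0Pn; exists (inr p); rewrite inE.
- case=> [x|p]; rewrite inE.
    case/existsP=> p /and3P[pH xp /existsP[q /andP[]]]; rewrite !inE => /andP[qp qH] xq.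
    exists (inr p), (inr q); split; rewrite ?inE //=.
    by apply: contraNneq qp => -[->].
  move=> pH; apply: contrapT => nop; apply: noleaf; exists p => // x x' xp x'p xH x'H.
  apply: contrapT => /eqP xx'; apply: nop; exists (inl x), (inl x').
  by split=> //=; [exact: VH xH|exact: VH x'H].
have := gE _ ccyc c2; rewrite ltnNge => /negP; apply.
rewrite (leq_trans (ucycle_adj_size ccyc)) // -mul2n leq_mul2l /=.
have uc : uniq c by case/andP: ccyc.
rewrite -size_filter -(card_uniqP (filter_uniq _ uc)) -(card_imset _ (@inr_inj X Y)).
apply: subset_leq_card; apply/subsetP => u; rewrite mem_filter.
case: u => // y /andP[_ /cV]; rewrite inE => yH; exact: imset_f.
Qed.

(* [A x] is the bit of block [x], which directs [x] to the edges [(x, y)] with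
   [side x y = A x]. *)
Lemma orientation E (side : X -> Y -> bool) (H : {set Y}) :
  girth_gt E (2 * #|H|) ->
  exists A : X -> bool, forall y x x', y \in H -> (x, y) \in E -> (x', y) \in E ->
    A x = side x y -> A x' = side x' y -> x = x'.
Proof.
have [k] := ubnP #|H|; elim: k H => // k IH H Hk gE.
have [->|H0] := eqVneq H set0; first by exists xpredT => y x x'; rewrite inE.
have [p pH leaf] := leaf_position gE H0.
have Hp : #|H| = #|H :\ p|.+1 by rewrite (cardsD1 p) pH.
have [||A AP] := IH (H :\ p); first by rewrite -ltnS -Hp.
  by move=> c cc c2; apply: leq_ltn_trans (gE _ cc c2); rewrite leq_mul2l Hp leqnSn.
(* Blocks whose only position in [H] is [p] turn away from [p]; at most one other block is adjacent
   to [p]. The rest of [H] does not see the change. *)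
pose A' x := if ((x, p) \in E) && ~~ meets E (H :\ p) x then ~~ side x p else A x.
exists A' => y x x' yH xy x'y.
have [yp|yp] := eqVneq y p.
  subst y; rewrite /A' xy x'y /=.
  have [xm|xm] := boolP (meets _ _ x); last by case: (side x p).
  have [x'm|x'm] := boolP (meets _ _ x'); last by move=> /= _; case: (side x' p).
  by move=> _ _; apply: leaf.
have yHp : y \in H :\ p by rewrite !inE yp.
have m z : (z, y) \in E -> A' z = A z.
  move=> zy; rewrite /A' [meets _ _ _](_ : _ = true) ?andbF //.
  by apply/existsP; exists y; rewrite yHp.
by rewrite !m //; apply: AP.
Qed.


Definition nbX E x := [set y | (x, y) \in E].
Definition nbY E y := [set x | (x, y) \in E].

Fixpoint ball E j u : {set X + Y} :=
  u |: if j is j'.+1 then \bigcup_(v in adj E u) ball E j' v else set0.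

Lemma path_ball E j u s : path (adj E) u s -> size s <= j -> last u s \in ball E j u.
Proof.
elim: j u s => [|j IH] u [|v s] //=; rewrite ?inE ?eqxx // ltnS => /andP[uv ps] sj.
by apply/orP; right; apply/bigcupP; exists v => //; exact: IH.
Qed.

Lemma card_ball E j u d :
  (forall x, #|nbX E x| <= d) -> (forall y, #|nbY E y| <= d) ->
  #|ball E j u| <= d.+1 ^ j.
Proof.
move=> dX dY.
have dV v : #|[pred w in adj E v]| <= d.
  case: v => [x|y].
    rewrite (leq_trans _ (dX x)) // -(card_imset _ (@inr_inj X Y)).
    apply: subset_leq_card; apply/subsetP => -[//|y]; rewrite inE => xy.
    by apply: imset_f; rewrite inE.
  rewrite (leq_trans _ (dY y)) // -(card_imset _ (@inl_inj X Y)).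
  apply: subset_leq_card; apply/subsetP => -[x|//]; rewrite inE => xy.
  by apply: imset_f; rewrite inE.
elim: j u => [|j IH] u /=; first by rewrite setU0 cards1.
rewrite (leq_trans (leq_card_setU _ _)) // cards1 expnS mulSn leq_add ?expn_gt0 //.
apply: (@leq_trans (\sum_(v in adj E u) d.+1 ^ j)); last first.
  by rewrite sum_nat_const leq_mul2r dV orbT.
elim/big_rec2: _ => [|v k B _ kB]; first by rewrite cards0.
by rewrite (leq_trans (leq_card_setU _ _)) // leq_add.
Qed.

Lemma adj_addE E x y u v : adj ((x, y) |: E) u v ->
  [\/ adj E u v, u = inl x /\ v = inr y | u = inr y /\ v = inl x].
Proof.
case: u v => [x'|y'] [x''|y''] //=; rewrite !inE => /orP[/eqP[-> ->]|h];
  by [constructor 1|constructor 2|constructor 3].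
Qed.

(** A cycle of size at most [L] must use the new edge; without it, a path of fewer than [L] steps
    joins [x] and [y] in [E]. *)
Lemma girth_add E L x y :
  girth_gt E L -> (forall s, path (adj E) (inl x) s -> last (inl x) s = inr y -> L <= size s) ->
  girth_gt ((x, y) |: E) L.
Proof.
move=> gE far c cc c2; rewrite ltnNge; apply/negP => cL.
have /andP[cyc uc] := cc.
have [cE|ncE] := boolP (cycle (adj E) c).
  by have : L < size c; [apply: gE; rewrite // /ucycle /ucycleb cE | rewrite ltnNge cL].
have [v vc nvE] : exists2 v, v \in c & ~~ adj E v (next c v).
  apply: contrapT => nov; move/negP: ncE; apply; apply: cycle_from_next => // v vc.
  by apply: contrapT => /negP nvE; apply: nov; exists v.
have [i s rc] := rot_to vc.
case: s rc => [|w s] rc; first by move: c2; rewrite -(size_rot i c) rc.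
have uvws : uniq [:: v, w & s] by rewrite -rc rot_uniq.
have nw : next c v = w by rewrite -(next_rot i uc) rc /= eqxx.
rewrite nw {nw vc} in nvE.
have : cycle (adj ((x, y) |: E)) [:: v, w & s] by rewrite -rc rot_cycle.
have sc : size c = (size s).+2 by rewrite -(size_rot i c) rc.
rewrite {}sc in c2 cL.
rewrite /= rcons_path => /and3P[vw pws lv].
have vwxy : (v = inl x /\ w = inr y) \/ (v = inr y /\ w = inl x).
  by case: (adj_addE vw) => [h|h|h]; [rewrite h in nvE|left|right].
have avoid g h : adj ((x, y) |: E) g h -> ~ (g = v /\ h = w) -> ~ (g = w /\ h = v) ->
    adj E g h.
  by move=> /adj_addE[//|[-> ->]|[-> ->]]; case: vwxy => -[-> ->]; tauto.
move: uvws; rewrite /= inE negb_or => /andP[/andP[vNw vNs] /andP[wNs us]].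
have pE : path (adj E) w (rcons s v).
  rewrite rcons_path; apply/andP; split.
    apply: (@sub_in_path _ (predC1 v)) pws.
      by move=> g h /eqP gv /eqP hv gh; apply: avoid => // -[].
    rewrite /= eq_sym vNw; apply/allP => z zs /=.
    by apply: contraNneq vNs => <-.
  apply: avoid => // -[]; first by move=> _ vw'; rewrite vw' eqxx in vNw.
  case/lastP: s {rc pws lv vNs us cL} c2 wNs => [//|s z] _ wNs.
  by rewrite last_rcons => zw _; rewrite -zw mem_rcons mem_head in wNs.
have short : L <= (size s).+1 -> False by move/(leq_trans cL); rewrite ltnn.
case: vwxy => -[vE wE]; last first.
  apply: short; rewrite -(size_rcons s v); apply: far; first by rewrite -wE.
  by rewrite last_rcons vE.
(* Here the path runs from [y] to [x] and has to be reversed. *)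
apply: short; rewrite -(size_rcons s v) -(size_belast w) -size_rev; apply: far.
  rewrite -vE; have := rev_path (adj E) w (rcons s v); rewrite last_rcons => ->.
  by rewrite (eq_path (e' := adj E)) // => g h; exact: adj_sym.
by rewrite belast_rcons rev_cons last_rcons.
Qed.

Lemma card_edges_le E d : (forall x, #|nbX E x| <= d) -> #|E| <= d * #|X|.
Proof.
move=> dX; rewrite -sum1_card (partition_big fst predT) //= mulnC -sum_nat_const.
apply: leq_sum => x _; rewrite sum1dep_card (leq_trans _ (dX x)) //.
have inj : injective (fun y : Y => (x, y)) by move=> ? ? [].
rewrite -(card_imset _ inj).
apply: subset_leq_card; apply/subsetP => -[x' y]; rewrite inE /= => /andP[xy /eqP xx'].
by subst x'; apply: imset_f; rewrite inE.
Qed.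

(** In a maximal good graph, a block [x] of degree below [D1] can be joined to any position that is
    neither of full degree nor within distance [L - 1]; counting leaves such a position. As [1 < L],
    it is not yet adjacent to [x]. *)
Lemma regular_graph D1 D2 L : 1 < L ->
  D1 * #|X| + D2 * (maxn D1 D2).+1 ^ L.-1 < D2 * #|Y| ->
  exists2 E, girth_gt E L & forall x, #|nbX E x| = D1.
Proof.
move=> L1 big.
pose good E := `[< [/\ girth_gt E L, forall x, #|nbX E x| <= D1 & forall y, #|nbY E y| <= D2] >].
have good0 : good set0.
  apply/asboolP; split.
  - move=> [//|u [//|v s]] /andP[/= /andP[+ _] _].
    by case: u v => ? [] ? //=; rewrite inE.
  - by move=> x; rewrite eq_card0 // => y; rewrite !inE.
  - by move=> x; rewrite eq_card0 // => y; rewrite !inE.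
have [E /maxsetP[/asboolP[gE dX dY] maxE] _] := maxset_exists good0.
exists E => // x; apply/eqP; rewrite eqn_leq dX /= leqNgt; apply/negP => xD.
pose full := [set y | #|nbY E y| == D2].
have fullE : D2 * #|full| <= #|E|.
  apply: (@leq_mul_card _ _ _ _ (fun y e => e.2 == y)).
    move=> y; rewrite inE => /eqP <-.
    have inj : injective (fun x : X => (x, y)) by move=> ? ? [].
    rewrite -(card_imset _ inj).
    apply: subset_leq_card; apply/subsetP => e /imsetP[x']; rewrite !inE => xy ->.
    by rewrite xy eqxx.
  by move=> e y y' _ _ _ /eqP<- /eqP<-.
pose near := [set y | inr y \in ball E L.-1 (inl x)].
have nearE : #|near| <= (maxn D1 D2).+1 ^ L.-1.
  apply: leq_trans (card_ball (E := E) (d := maxn D1 D2) L.-1 (inl x) _ _).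
  - rewrite -(card_imset _ (@inr_inj X Y)); apply: subset_leq_card.
    by apply/subsetP => u /imsetP[y]; rewrite inE => yb ->.
  - by move=> x'; rewrite (leq_trans (dX x')) // leq_maxl.
  - by move=> y; rewrite (leq_trans (dY y)) // leq_maxr.
have [y /norP[yfull ynear]] : exists y, ~~ ((y \in full) || (y \in near)).
  apply: contrapT => noy; move: big; rewrite ltnNge => /negP; apply.
  rewrite (leq_trans _ (leq_add (leq_trans fullE (card_edges_le dX))
    (leq_mul (leqnn D2) nearE))) //.
  rewrite -mulnDr leq_mul2l; apply/orP; right; apply: leq_trans (leq_card_setU _ _).
  rewrite -cardsT; apply: subset_leq_card; apply/subsetP => y _; rewrite in_setU.
  by apply: contrapT => /negP h; apply: noy; exists y.
have far s : path (adj E) (inl x) s -> last (inl x) s = inr y -> L <= size s.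
  move=> ps ls; rewrite leqNgt; apply: contra ynear => sL.
  by rewrite inE -ls path_ball // -ltnS prednK // ltnW.
have xyE : (x, y) \notin E.
  by apply/negP => xy; have := far [:: inr y]; rewrite /= xy => /(_ isT erefl); rewrite leqNgt L1.
suff /maxE/(_ (subsetUr _ _)) EE : good ((x, y) |: E).
  by move/negP: xyE; apply; rewrite -EE !inE eqxx.
apply/asboolP; split; first exact: girth_add.
- move=> x'; have [->|xx'] := eqVneq x' x.
    rewrite (leq_trans _ xD) // -[_.+1]addn1 addnC -(cards1 y).
    apply: leq_trans (leq_card_setU _ _); apply: subset_leq_card.
    by apply/subsetP => y'; rewrite !inE xpair_eqE eqxx.
  rewrite (leq_trans _ (dX x')) //; apply: subset_leq_card.
  by apply/subsetP => y'; rewrite !inE xpair_eqE (negbTE xx').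
- move=> y'; have [->|yy'] := eqVneq y' y.
    have yD : #|nbY E y| < D2 by rewrite ltn_neqAle dY andbT; move: yfull; rewrite inE.
    rewrite (leq_trans _ yD) // -[_.+1]addn1 addnC -(cards1 x).
    apply: leq_trans (leq_card_setU _ _); apply: subset_leq_card.
    by apply/subsetP => x'; rewrite !inE xpair_eqE eqxx andbT.
  rewrite (leq_trans _ (dY y')) //; apply: subset_leq_card.
  by apply/subsetP => x'; rewrite !inE xpair_eqE (negbTE yy') andbF.
Qed.

End BipartiteGraph.

(** Element [u] is block [u %/ k] with its edges labelled [(false, u %% k)] and [(true, u %% k)].
    Position degrees up to [4 * k], twice the block degree, leave at most half of the positions
    full, and a ball takes less than the other half. *)
Lemma scheme_upper_bound m n k N : 0 < n -> 0 < k -> m <= N * k ->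
  2 * (4 * k).+1 ^ (4 * n).-1 < N -> has_scheme m n (N + N) 2.
Proof.
move=> n0 k0 mNk ballN.
have [|| E gE degE] := @regular_graph 'I_N 'I_N (2 * k) (4 * k) (4 * n).
- by rewrite (leq_trans (ltnSn 1)) // (leq_trans _ (leq_pmulr 4 n0)).
- rewrite card_ord (maxn_idPr _) ?leq_mul2r ?orbT //.
  move: ballN; move: (_ ^ _) => b ballN.
  have := ltn_mul2l (2 * k) (2 * b) N; rewrite ballN muln_gt0 k0 /=; nia.
have /choice[g gP] x : exists g : bool * 'I_k -> 'I_N,
    injective g /\ forall bc, (x, g bc) \in E.
  have e : #|{: bool * 'I_k}| = #|nbX E x| by rewrite degE card_prod card_bool card_ord.
  exists (fun bc => enum_val (cast_ord e (enum_rank bc))); split.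
    by move=> bc bc' /enum_val_inj/cast_ord_inj/enum_rank_inj.
  by move=> bc; have := enum_valP (cast_ord e (enum_rank bc)); rewrite inE.
have ltN (u : 'I_m) : u %/ k < N by rewrite ltn_divLR // (leq_trans (ltn_ord u)).
have ltk (u : 'I_m) : u %% k < k by rewrite ltn_mod.
pose blk u := Ordinal (ltN u); pose idx u := Ordinal (ltk u).
pose addr u b := g (blk u) (b, idx u).
have addr_inj u v b : addr u b = addr v b -> blk u = blk v -> u = v.
  rewrite /addr => + bb; rewrite -bb => /(gP _).1[ii]; apply: val_inj.
  have [quo rem] : u %/ k = v %/ k /\ u %% k = v %% k by case: bb.
  by rewrite /= (divn_eq u k) (divn_eq v k) quo rem.
pose side x y := [exists c, g x (true, c) == y].
have sideE u b : side (blk u) (addr u b) = b.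
  case: b; first by apply/existsP; exists (idx u).
  by apply/existsP => -[c /eqP/(gP _).1[]].
have /choice[A AP] (S : {S : {set 'I_m} | #|S| <= n}) : exists A : 'I_N -> bool,
    forall u v, u \in sval S -> addr u (A (blk u)) = addr v (A (blk v)) -> u = v.
  pose H := (addr^~ false @: sval S) :|: (addr^~ true @: sval S).
  have [|A AP] := @orientation _ _ E side H.
    move=> c cc c2; apply: leq_ltn_trans (gE _ cc c2).
    rewrite -[4]/(2 * 2) -mulnA leq_mul2l /= mul2n -addnn.
    rewrite (leq_trans (leq_card_setU _ _)) //.
    by apply: leq_add; apply: leq_trans (leq_imset_card _ _) (svalP S).
  exists A => u v uS uv.
  have bb : blk u = blk v.
    (* The common position is in [H] because [u] is in [S]; [v] need not be. *)
    apply: (AP (addr u (A (blk u)))); rewrite ?sideE //.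
    - by rewrite in_setU; case: (A (blk u)); apply/orP; [right|left]; apply/imsetP; exists u.
    - exact: (gP _).2.
    - by rewrite uv; exact: (gP _).2.
    - by rewrite uv sideE.
  by apply: (addr_inj _ _ (A (blk u))) => //; rewrite uv bb.
pose phi (S : {S : {set 'I_m} | #|S| <= n}) := [tuple match split i with
  | inl x => A S x
  | inr y => [exists u in sval S, addr u (A S (blk u)) == y] end | i < N + N].
pose T u := Probe (lshift N (blk u))
  (Probe (rshift N (addr u false)) (Leaf false) (Leaf true))
  (Probe (rshift N (addr u true)) (Leaf false) (Leaf true)).
have dT u : depth (T u) <= 2 by [].
exists phi, (fun u => exist _ (T u) (dT u)) => S u /=.
rewrite !tnth_mktuple (unsplitK (inl _)) !(unsplitK (inr _)) -/(A S _).
have if_eta (b c d : bool) : (if b then if c then true else false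
    else if d then true else false) = if b then c else d by case: b c d => [] [] [].
rewrite if_eta.
split=> [h|uS].
  have : [exists v in sval S, addr v (A S (blk v)) == addr u (A S (blk u))].
    by move: h; case: (A S (blk u)).
  by case/existsP => v /andP[vS /eqP/(AP S _ _ vS)<-].
have : [exists v in sval S, addr v (A S (blk v)) == addr u (A S (blk u))].
  by apply/existsP; exists u; rewrite uS eqxx.
by case: (A S (blk u)).
Qed.

(** * Asymptotics *)

Import Order.TTheory GRing.Theory Num.Theory.
Local Open Scope ring_scope.

Lemma natr_root (R : realType) (m q K : nat) : (0 < q)%N -> (0 < K)%N ->
  (K ^ q <= m)%N ->
  exists y : R, [/\ K%:R <= y, y ^+ q = m%:R & m%:R `^ (1 - 1 / q%:R) = m%:R / y].
Proof.
move=> q0 K0 Km; have m0 : (0 < m)%N by rewrite (leq_trans _ Km) // expn_gt0 K0.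
have q0' : q%:R != 0 :> R by rewrite pnatr_eq0 -lt0n.
have yq : (m%:R `^ (1 / q%:R)) ^+ q = m%:R :> R.
  by rewrite -powR_mulrn ?powR_ge0 // -powRrM divfK // powRr1.
exists (m%:R `^ (1 / q%:R)); split => //.
  by rewrite -(@ler_pXn2r _ q) ?nnegrE ?ler0n ?powR_ge0 // yq -natrX ler_nat.
by rewrite powRB ?powRr1 ?ler0n // pnatr_eq0 -lt0n m0 implybT.
Qed.

(** Take [k] the integer part of [y = m^(1/(4n+1))] and [N = m %/ k + 1]. Then
    [2 * N <= 4 * (m %/ k)] and [y <= 2 * k] give the constant 8. The threshold on [m] yields
    [2 * 5^(4n-1) <= k], which absorbs the ball. *)
Lemma min_space_upper (R : realType) (n m : nat) : (0 < n)%N ->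
  ((2 * 5 ^ (4 * n).-1) ^ (4 * n + 1) <= m)%N ->
  (min_space m n 2)%:R <= 8 * m%:R `^ (1 - 1 / (4 * n + 1)%:R) :> R.
Proof.
move=> n0 Km; have K0 : (0 < 2 * 5 ^ (4 * n).-1)%N by rewrite muln_gt0 expn_gt0.
have q0 : (0 < 4 * n + 1)%N by rewrite addn1.
have [y [Ky yq ->]] := natr_root R q0 K0 Km.
have y0 : 0 < y by rewrite (lt_le_trans _ Ky) // ltr0n.
pose k := Num.truncn y; have /andP[ky yk] := truncn_itv (ltW y0).
rewrite -/k in ky yk.
have Kk : (2 * 5 ^ (4 * n).-1 <= k)%N by rewrite truncn_ge_nat // ltW.
have k0 : (0 < k)%N by rewrite (leq_trans K0).
have kq : (k ^ (4 * n) <= m %/ k)%N.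
  rewrite leq_divRL // -expnSr -addn1 -(ler_nat R) natrX -yq.
  by rewrite ler_pXn2r ?nnegrE ?ler0n // ltW.
have ball : (2 * (4 * k).+1 ^ (4 * n).-1 <= m %/ k)%N.
  apply: leq_trans kq; rewrite -[X in (_ <= _ ^ X)%N](@prednK (4 * n)); last by lia.
  rewrite expnS; apply: (@leq_trans (2 * (5 * k) ^ (4 * n).-1)%N).
    by rewrite leq_mul2l leq_exp2r //; [apply/orP; right; lia|lia].
  by rewrite expnMn mulnA leq_mul2r Kk orbT.
have h := @scheme_upper_bound m n k (m %/ k).+1 n0 k0 (ltnW (ltn_ceil m k0)) ball.
have := (min_spaceP m n (isT : (0 < 2)%N)).2 _ h; rewrite -(ler_nat R) => /le_trans; apply.
rewrite mulrA ler_pdivlMr // -natrM.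
have mk0 : (1 <= m %/ k)%N by rewrite (leq_trans _ kq) // expn_gt0 k0.
have mkm : ((m %/ k) * k <= m)%N by exact: leq_trunc_div.
have : y <= (2 * k)%:R by rewrite (le_trans (ltW yk)) // ler_nat; lia.
move=> /(ler_wpM2l (ler0n _ ((m %/ k).+1 + (m %/ k).+1))) /le_trans; apply.
by rewrite -natrM ler_nat; nia.
Qed.

(** With [r = n %/ 4] and [y = m^(1/r)], suppose [s * y < m] and take [d] the integer part of
    [y / 96], [t = r - 1]. The threshold gives [d - 4 * r >= y / 192] and [y >= 192^r], so
    [(d - 4 * r)^r >= m / 192^r > s]. *)
Lemma min_space_lower (R : realType) (n m : nat) : (4 <= n)%N ->
  ((192 ^ (n %/ 4) * (4 * (n %/ 4) + 1)) ^ (n %/ 4) <= m)%N ->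
  m%:R `^ (1 - 1 / (n %/ 4)%:R) <= (min_space m n 2)%:R :> R.
Proof.
move=> n4; have r0 : (0 < n %/ 4)%N by rewrite divn_gt0.
have : (n %/ 4 * 4 <= n)%N by exact: leq_trunc_div.
move: (n %/ 4)%N r0 => r r0 rn Km.
have K0 : (0 < 192 ^ r * (4 * r + 1))%N by rewrite muln_gt0 expn_gt0 addn1.
have [y [Ky yr ->]] := natr_root R r0 K0 Km.
have y0 : 0 < y by rewrite (lt_le_trans _ Ky) // ltr0n.
have m0 : (0 < m)%N by rewrite -(ltr_nat R) -yr exprn_gt0.
have [hs _] := min_spaceP m n (isT : (0 < 2)%N).
set s := min_space m n 2 in hs *.
have s0 : (0 < s)%N by apply: has_scheme_gt0 hs => //; exact: leq_trans n4.
rewrite leNgt; apply/negP; rewrite ltr_pdivlMr // => sy.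
pose d := Num.truncn (y / 96).
have /andP[dy yd] := truncn_itv (divr_ge0 (ltW y0) (ler0n R 96)).
rewrite -/d in dy yd.
have sd : (48 * s * d < m)%N.
  rewrite -(ltr_nat R) (le_lt_trans _ sy) // !natrM -mulrA mulrCA ler_wpM2l ?ler0n //.
  by move: dy; rewrite ler_pdivlMr; lra.
have [t rt] : exists t, r = t.+1 by exists r.-1; rewrite prednK.
have : ((d - (4 * t + 4)) ^ r <= s)%N.
  by rewrite rt; apply: scheme_lower_bound hs _ sd => //; lia.
apply/negP; rewrite -ltnNge.
have K1 : (192 * (4 * r + 1) <= 192 ^ r * (4 * r + 1))%N.
  by rewrite leq_mul2r rt expnS leq_pmulr ?orbT // expn_gt0.
have K2 : (192 ^ r <= 192 ^ r * (4 * r + 1))%N by rewrite leq_pmulr // addn1.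
rewrite -!(ler_nat R) in K1 K2.
have y1 := le_trans K1 Ky; have y2 := le_trans K2 Ky.
have yd' : y / 192 <= (d - (4 * t + 4))%:R.
  apply: (@le_trans _ _ (d%:R - (4 * r)%:R)).
    by move: yd y1; rewrite ltr_pdivrMr // -natr1 !natrM natrD natrM; lra.
  by rewrite lerBlDr -natrD ler_nat rt mulnSr addnC -leq_subLR.
rewrite -(ltr_nat R) natrX; apply: lt_le_trans (_ : (y / 192) ^+ r <= _); last first.
  by rewrite ler_pXn2r ?nnegrE ?ler0n // divr_ge0 ?ler0n // ltW.
rewrite expr_div_n ltr_pdivlMr ?exprn_gt0 // yr (le_lt_trans _ sy) //.
by rewrite ler_wpM2l ?ler0n // -natrX.
Qed.

Theorem theorem2 (R : realType) :
  (exists C : R, 0 < C /\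
     forall n : nat, (0 < n)%N ->
     exists m0 : nat, forall m : nat, (m0 <= m)%N ->
       (min_space m n 2)%:R <= C * m%:R `^ (1 - 1 / (4 * n + 1)%:R)) /\
  (forall n : nat, (4 <= n)%N ->
     exists D : R, 0 < D /\
     exists m0 : nat, forall m : nat, (m0 <= m)%N ->
       (min_space m n 2)%:R >= D * m%:R `^ (1 - 1 / (n %/ 4)%:R)).
Proof.
split.
  exists 8; split=> // n n0.
  exists ((2 * 5 ^ (4 * n).-1) ^ (4 * n + 1))%N => m.
  exact: min_space_upper.
move=> n n4; exists 1; split=> //.
exists ((192 ^ (n %/ 4) * (4 * (n %/ 4) + 1)) ^ (n %/ 4))%N => m Km.
by rewrite mul1r; exact: min_space_lower.
Qed.
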